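(* Let $T$ be an orientation (tournament) of the complete graph $K_8$. If there exists a vertex $v \in V(T)$ such that $id(v)=1$ or $od(v)=1$, then $\gamma^{*}(T) \leq 4$.
   Context: For a digraph $D=(V,A)$ and $v \in V$, $I(v)=\{u : (u,v)\in A\}$, $O(v)=\{u : (v,u)\in A\}$, $id(v)=|I(v)|$ and $od(v)=|O(v)|$. A subset $S \subseteq V$ is a twin dominating set of $D$ if for every vertex $v \in V - S$ there exist vertices $u_1, u_2 \in S$ (possibly equal) such that $(v,u_1)$ and $(u_2,v)$ are arcs of $D$. The twin domination number $\gamma^{*}(D)$ is the minimum cardinality of a twin dominating set of $D$. *)

(* Defs.v *)
(* A finite digraph is a relation [a : rel V] on a finite type [V];
   [a u v] means that (u,v) is an arc. *)
From mathcomp Require Import all_boot.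

Set Implicit Arguments.
Unset Strict Implicit.
Unset Printing Implicit Defensive.

Section Digraph.

Variables (V : finType) (a : rel V).

Definition in_nbrs (v : V) : {set V} := [set u | a u v].
Definition out_nbrs (v : V) : {set V} := [set u | a v u].
Definition indeg (v : V) : nat := #|in_nbrs v|.
Definition outdeg (v : V) : nat := #|out_nbrs v|.

Definition twin_dominating (S : {set V}) : bool :=
  [forall v in ~: S,
     [exists u1 in S, exists u2 in S, a v u1 && a u2 v]].

Lemma twin_dominating_setT : twin_dominating [set: V].
Proof. by apply/forall_inP => v; rewrite !inE. Qed.

(* The default [set: V] is twin dominating, so this is the true minimum. *)
Definition twin_domination_number : nat :=
  #|[arg min_(S < [set: V] | twin_dominating S) #|S|]|.

(* Exactly one of (u,v), (v,u) is an arc when u and v are distinct. *)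
Definition tournament : Prop :=
  irreflexive a /\ forall u v : V, u != v -> a u v (+) a v u.

End Digraph.

(* Main.v *)
(* If [id v = 1] with [I(v) = {u}], then [v] dominates the 6-set [O(v)]. Every
   tournament on at most 6 vertices has two vertices [P] such that every other
   vertex has an out-neighbour in [P]: by averaging, some [p] has at least as
   many in-neighbours as out-neighbours, so at most 2 vertices remain
   unabsorbed after choosing [p], and one more vertex handles them. Then
   [{v, u}] together with [P] is twin dominating. Reversing all arcs gives the
   case [od v = 1]. *)
Require Import Defs.
From mathcomp Require Import all_boot zify.

(** Double counting: both sides are the number of arcs inside [W], grouped by tail on the left and
    by head on the right. *)
Lemma sum_card_in_out_nbrs (V : finType) (a : rel V) (W : {set V}) :
  \sum_(p in W) #|W :&: out_nbrs a p| = \sum_(p in W) #|W :&: in_nbrs a p|.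
Proof.
have card_sum (b : rel V) p :
    #|W :&: [set x | b p x]| = \sum_(x in W) b p x.
  rewrite -sum1_card big_mkcond [RHS]big_mkcond; apply: eq_bigr => x _.
  by rewrite !inE; case: (x \in W); case: (b p x).
under eq_bigr do rewrite card_sum.
under [RHS]eq_bigr => p _ do rewrite (card_sum (fun p x => a x p)).
exact: exchange_big.
Qed.

Lemma exists_out_le_in (V : finType) (a : rel V) (W : {set V}) :
  W != set0 ->
  exists2 p, p \in W & #|W :&: out_nbrs a p| <= #|W :&: in_nbrs a p|.
Proof.
case/set0Pn => w wW; apply/exists_inP; apply: contraT.
rewrite negb_exists_in => /forall_inP in_lt_out.
have /eqP := sum_card_in_out_nbrs V a W; rewrite gtn_eqF //.
(* The term at [w] is split off to make the inequality of sums strict; weak inequality suffices for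
   the other terms. *)
rewrite (bigD1 w) //= [ltnRHS](bigD1 w) //= -addSn leq_add //.
  by rewrite ltnNge in_lt_out.
by apply: leq_sum => p /andP[pW _]; rewrite ltnW // ltnNge in_lt_out.
Qed.

Lemma card_tournament_nbrs (V : finType) (a : rel V) (W : {set V}) p :
  tournament a -> p \in W ->
  #|W| = (#|W :&: in_nbrs a p| + #|W :&: out_nbrs a p|).+1.
Proof.
case=> irr_a tot_a pW; rewrite (cardsD1 p) pW add1n -cardsUI; congr _.+1.
have -> : (W :&: in_nbrs a p) :&: (W :&: out_nbrs a p) = set0.
  apply/setP => x; rewrite !inE; case: (eqVneq x p) => [->|/tot_a].
    by rewrite irr_a andbF.
  by case: (x \in W); case: (a x p); case: (a p x).
rewrite cards0 addn0; apply: eq_card => x; rewrite !inE.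
case: eqVneq => [->|/tot_a] /=; first by rewrite irr_a andbF.
by case: (x \in W); case: (a x p); case: (a p x).
Qed.

(** Induction on [k]: a vertex [p] with at least as many in- as out-neighbours in [W] absorbs all of
    [W] but itself and its out-neighbours. At most [(#|W| - 1) / 2] of these remain, so [#|W| + 1]
    is at least halved at each choice. *)
Lemma small_absorbing_set (V : finType) (a : rel V) k (W : {set V}) :
  tournament a -> #|W|.+1 < 2 ^ k.+1 ->
  exists2 P : {set V}, #|P| <= k &
    forall x, x \in W :\: P -> exists2 y, y \in P & a x y.
Proof.
move=> tour_a; elim: k W => [|k IHk] W ltW.
  have /eqP/cards0_eq -> : #|W| == 0 by move: ltW; rewrite expn1; lia.
  by exists set0 => [|x]; rewrite ?cards0 // !inE andbF.
have [->|/(exists_out_le_in V a)[p pW le_oi]] := eqVneq W set0.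
  by exists set0 => [|x]; rewrite ?cards0 // !inE andbF.
have cardW := card_tournament_nbrs V a W p tour_a pW.
have [|P leP absP] := IHk (W :&: out_nbrs a p).
  by move: ltW; rewrite expnS; lia.
exists (p |: P) => [|x].
  by rewrite cardsU1; case: (p \notin P) => /=; lia.
rewrite !inE negb_or => /andP[/andP[neq_xp xP] xW].
have [_ /(_ _ _ neq_xp)] := tour_a.
case axp: (a x p) => /= apx; first by exists p; rewrite ?setU11.
have [|y yP axy] := absP x; first by rewrite !inE xP xW apx.
by exists y; rewrite // setU1r.
Qed.

Lemma twin_domination_number_le (V : finType) (a : rel V) (S : {set V}) :
  twin_dominating a S -> twin_domination_number a <= #|S|.
Proof.
rewrite /twin_domination_number; case: arg_minnP => [|S0 _ minS0 /minS0 //].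
exact: twin_dominating_setT.
Qed.

Definition converse {V : finType} (a : rel V) : rel V := fun u v => a v u.

Lemma converse_tournament (V : finType) (a : rel V) :
  tournament a -> tournament (converse a).
Proof. by case=> irr_a tot_a; split=> // u v /tot_a; rewrite addbC. Qed.

(** Reversing the arcs only swaps the roles of the two witnesses. *)
Lemma twin_dominating_converse (V : finType) (a : rel V) (S : {set V}) :
  twin_dominating (converse a) S -> twin_dominating a S.
Proof.
move/forall_inP=> domS; apply/forall_inP => x /domS.
move=> /exists_inP[u1 u1S /exists_inP[u2 u2S /andP[xu1 u2x]]].
apply/exists_inP; exists u2 => //; apply/exists_inP; exists u1 => //.
exact/andP.
Qed.

Lemma indeg1_twin_dominating (V : finType) (a : rel V) k (v : V) :
  tournament a -> indeg a v = 1 -> #|V| <= 2 ^ k.+1 ->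
  exists2 S : {set V}, twin_dominating a S & #|S| <= k.+2.
Proof.
move=> tour_a indeg_v leV; have /cards1P[u Iv] : #|in_nbrs a v| == 1 by apply/eqP.
have cardV : #|V| = (outdeg a v).+2.
  rewrite -cardsT (card_tournament_nbrs V a _ v tour_a) ?inE //.
  by rewrite !setTI Iv cards1.
have [|P leP absP] := small_absorbing_set V a k (out_nbrs a v) tour_a.
  (* Since [O(v)] omits only [v] and [u], the strict bound on [#|O(v)| + 1] is exactly the bound on
     [#|V|]. *)
  by rewrite -[_.+2]cardV.
exists (v |: (u |: P)); last by rewrite !cardsU1; lia.
apply/forall_inP => x; rewrite !inE !negb_or => /and3P[neq_xv neq_xu xP].
(* As [u] is the only in-neighbour of [v], the arc goes from [v] to [x]: [v] serves as in-witness
   for every such [x], and [P] supplies the out-witness. *)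
have axv : a x v = false.
  by have /setP/(_ x) := Iv; rewrite !inE (negPf neq_xu).
have avx : a v x by case: tour_a => _ /(_ _ _ neq_xv); rewrite axv.
have [|y yP axy] := absP x; first by rewrite !inE xP.
apply/exists_inP; exists y; first by rewrite !inE yP !orbT.
by apply/exists_inP; exists v; rewrite ?setU11 // axy.
Qed.

Theorem theorem2p3 (V : finType) (a : rel V)
    (card_V : #|V| = 8) (tour_a : tournament a)
    (deg1 : exists v : V, indeg a v = 1 \/ outdeg a v = 1) :
  twin_domination_number a <= 4.
Proof.
(* Order 8 is the extreme case for [k = 2], which gives the bound [k + 2 = 4]. *)
have leV : #|V| <= 2 ^ 3 by rewrite card_V.
suff [S domS leS] : exists2 S : {set V}, twin_dominating a S & #|S| <= 4.
  exact: leq_trans (twin_domination_number_le V a S domS) leS.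
case: deg1 => v [indeg_v|outdeg_v].
  exact: indeg1_twin_dominating tour_a indeg_v leV.
(* [outdeg a v] is [indeg (converse a) v] by conversion, so [outdeg_v] fits as it stands. *)
have [S domS leS] :=
  indeg1_twin_dominating V (converse a) 2 v (converse_tournament V a tour_a)
    outdeg_v leV.
by exists S => //; apply: twin_dominating_converse.
Qed.
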